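(* In the setting below, let $A$ be a type over $\Gamma$ and $B$ a type over $\Gamma.A$. If there are global elements $\mathbf{c}_A:\Phi(\Gamma,A)$ and $\mathbf{c}_B:\Phi(\Gamma.A,B)$, then there is a global element $\mathbf{c}:\Phi(\Gamma,\Pi(x:A).B)$.
   Context: Work in the internal extensional dependent type theory of a presheaf topos containing an object $\mathbb{I}$ which is internally a De Morgan algebra $(0,1,\wedge,\vee,1-\cdot)$ with $0\neq1$ and the disjunction property $i\vee j=1\Rightarrow(i=1\vee j=1)$. $\Omega$ is the type of propositions. $\mathbb{F}=\{p:\Omega\mid\exists i:\mathbb{I}.\ p=(i=1)\}$. For $\phi:\mathbb{F}$, $[\phi]$ is the subsingleton type $\mathrm{Id}_{\mathbb{F}}(\phi,\top)$. For a type $A$ and partial element $u:[\phi]\to A$, $A[\phi\mapsto u]=\Sigma(a:A).([\phi]\to\mathrm{Id}_A(a,u))$. Contexts $\Gamma$ are treated as closed types, $\Gamma.A=\Sigma(\gamma:\Gamma).A(\gamma)$, and for $\gamma:\mathbb{I}\to\Gamma$, $A(\gamma(i))$ denotes reindexing. The type of compositions is $\Phi(\Gamma,A)=\Pi(\gamma:\mathbb{I}\to\Gamma)(\phi:\mathbb{F})(u:\Pi(i:\mathbb{I}).[\phi]\to A(\gamma(i))).\ A(\gamma(0))[\phi\mapsto u(0)]\to A(\gamma(1))[\phi\mapsto u(1)]$. *)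

(* Defs.v *)
(* The internal extensional type theory of the presheaf topos is
   modelled by Rocq's own type theory (with propext for Omega). *)
From Stdlib Require Import PropExtensionality.

Record Interval : Type := {
  I :> Type;
  i0 : I;
  i1 : I;
  imeet : I -> I -> I;
  ijoin : I -> I -> I;
  irev : I -> I;
  meet_assoc : forall x y z, imeet x (imeet y z) = imeet (imeet x y) z;
  join_assoc : forall x y z, ijoin x (ijoin y z) = ijoin (ijoin x y) z;
  meet_comm : forall x y, imeet x y = imeet y x;
  join_comm : forall x y, ijoin x y = ijoin y x;
  meet_absorb : forall x y, imeet x (ijoin x y) = x;
  join_absorb : forall x y, ijoin x (imeet x y) = x;
  meet_distr : forall x y z, imeet x (ijoin y z) = ijoin (imeet x y) (imeet x z);
  join_zero : forall x, ijoin x i0 = x;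
  meet_one : forall x, imeet x i1 = x;
  rev_invol : forall x, irev (irev x) = x;
  rev_meet : forall x y, irev (imeet x y) = ijoin (irev x) (irev y);
  zero_neq_one : i0 <> i1;
  disj_prop : forall x y, ijoin x y = i1 -> x = i1 \/ y = i1
}.

Definition Cof (D : Interval) : Type := { p : Prop | exists i : I D, p = (i = i1 D) }.

Lemma cofTop_proof (D : Interval) : exists i : I D, True = (i = i1 D).
Proof. exists (i1 D). apply propositional_extensionality; split; auto. Qed.

Definition cofTop (D : Interval) : Cof D := exist _ True (cofTop_proof D).

Definition holds {D : Interval} (phi : Cof D) : Prop := phi = cofTop D.

Definition Ext {D : Interval} (A : Type) (phi : Cof D) (u : holds phi -> A) : Type :=
  { a : A | forall h : holds phi, a = u h }.

Definition Comp (D : Interval) (Gamma : Type) (A : Gamma -> Type) : Type :=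
  forall (gamma : I D -> Gamma) (phi : Cof D)
         (u : forall i : I D, holds phi -> A (gamma i)),
    Ext (A (gamma (i0 D))) phi (u (i0 D)) -> Ext (A (gamma (i1 D))) phi (u (i1 D)).

(* Main.v *)
(* Composition for [Pi (x : A). B] is pointwise: given a line [gamma], a
   partial family of functions [u] and a base function [u0], the composite at
   [a1 : A (gamma 1)] is obtained by first lifting [gamma] backwards to a line
   [a] in [A] ending at [a1], using the composition of [A] along the reversed
   line [j |-> gamma (i \/ ~j)], and then composing in [B] along
   [j |-> (gamma j, a j)] starting from [u0 (a 0)]. *)

Require Import Defs.
From Stdlib Require Import PropExtensionality ProofIrrelevance FunctionalExtensionality.

Section IntervalFacts.
Variable D : Interval.

Lemma ijoin1l (x : I D) : ijoin D (i1 D) x = i1 D.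
Proof.
  rewrite <- (join_absorb D (i1 D) x) at 2.
  now rewrite meet_comm, meet_one.
Qed.

Lemma irev1 : irev D (i1 D) = i0 D.
Proof.
  pose proof (rev_meet D (irev D (i0 D)) (i1 D)) as E.
  rewrite meet_one, rev_invol, join_comm, join_zero in E.
  now symmetry.
Qed.

Lemma irev0 : irev D (i0 D) = i1 D.
Proof. now rewrite <- irev1, rev_invol. Qed.

End IntervalFacts.

Definition cofEq (D : Interval) (i : I D) : Cof D :=
  exist _ (i = i1 D) (ex_intro _ i eq_refl).

Lemma holds_cofEq (D : Interval) (i : I D) : holds (cofEq D i) <-> i = i1 D.
Proof.
  split.
  - intro h. apply (f_equal (@proj1_sig _ _)) in h. simpl in h.
    now rewrite h.
  - intros ->. apply eq_sig_hprop.
    + intros; apply proof_irrelevance.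
    + apply propositional_extensionality; simpl; split; auto.
Qed.

Section Extensions.
Context {D : Interval} {X : Type} {P : X -> Type} {phi : Cof D}.
Variable f : holds phi -> forall x, P x.

Lemma Ext_app : Ext (forall x, P x) phi f -> forall x, Ext (P x) phi (fun h => f h x).
Proof. intros [g Hg] x. exists (g x). intro h. now rewrite (Hg h). Qed.

Lemma Ext_lam : (forall x, Ext (P x) phi (fun h => f h x)) -> Ext (forall x, P x) phi f.
Proof.
  intro e. exists (fun x => proj1_sig (e x)). intro h.
  apply functional_extensionality_dep. intro x.
  exact (proj2_sig (e x) h).
Qed.

Lemma Ext_rew {x y : X} : x = y -> Ext (P x) phi (fun h => f h x) -> Ext (P y) phi (fun h => f h y).
Proof. now intros <-. Qed.

End Extensions.

Lemma Ext_transport {D : Interval} {X : Type} (P : X -> Type) {phi : Cof D} {x y : X}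
    (e : x = y) (e' : holds phi -> x = y) (a : P x) :
  Ext (P y) phi (fun h => eq_rect x P a y (e' h)).
Proof.
  exists (eq_rect x P a y e). intro h.
  now rewrite (proof_irrelevance _ e (e' h)).
Qed.

Section PathLifting.
Context {D : Interval} {Gamma : Type} {A : Gamma -> Type}.
Hypothesis cA : Comp D Gamma A.

Lemma comp_path_lift (gamma : I D -> Gamma) (a1 : A (gamma (i1 D))) :
  {a : forall i, A (gamma i) | a (i1 D) = a1}.
Proof.
  set (Ag := fun k => A (gamma k)).
  set (rev_line := fun i j => ijoin D i (irev D j)).
  assert (start_one : forall i, i1 D = rev_line i (i0 D)).
  { intro i. unfold rev_line. now rewrite irev0, join_comm, ijoin1l. }
  assert (const_on_one : forall i j, holds (cofEq D i) -> i1 D = rev_line i j).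
  { intros i j h. apply holds_cofEq in h. unfold rev_line. now rewrite h, ijoin1l. }
  assert (end_id : forall i, rev_line i (i1 D) = i).
  { intro i. unfold rev_line. now rewrite irev1, join_zero. }
  pose (lift := fun i =>
    cA (fun j => gamma (rev_line i j)) (cofEq D i)
      (fun j h => eq_rect _ Ag a1 _ (const_on_one i j h))
      (Ext_transport Ag (start_one i) (const_on_one i (i0 D)) a1)).
  exists (fun i => eq_rect _ Ag (proj1_sig (lift i)) i (end_id i)).
  destruct (lift (i1 D)) as [v Hv]. simpl.
  rewrite (Hv (proj2 (holds_cofEq D (i1 D)) eq_refl)), rew_compose.
  symmetry. apply (Eq_rect_eq.eq_rect_eq _ _ Ag).
Qed.

End PathLifting.

Theorem mainTheorem17 (D : Interval) (Gamma : Type) (A : Gamma -> Type)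
    (B : {g : Gamma & A g} -> Type)
    (cA : Comp D Gamma A) (cB : Comp D {g : Gamma & A g} B) :
  Comp D Gamma (fun g => forall x : A g, B (existT _ g x)).
Proof.
  intros gamma phi u u0.
  apply Ext_lam. intro a1.
  destruct (comp_path_lift cA gamma a1) as [a a_end].
  apply (Ext_rew (P := fun x => B (existT _ (gamma (i1 D)) x)) (u (i1 D)) a_end).
  exact (cB (fun j => existT _ (gamma j) (a j)) phi (fun j h => u j h (a j))
            (Ext_app (u (i0 D)) u0 (a (i0 D)))).
Qed.
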